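(* Let $\mathcal{A}=(A_1,\dots,A_n)$ with $A_i\in\mathbb{Z}^{n\times m_i}$, $m=\sum_i m_i$, let $\omega=(\omega_1,\dots,\omega_n)\in\mathbb{R}^{m_1}\times\cdots\times\mathbb{R}^{m_n}=\mathbb{R}^m$, let $p$ be an isolated point of $T(A_1,\omega_1)\cap\cdots\cap T(A_n,\omega_n)$, and let $\omega'=(\omega'_1,\dots,\omega'_n)\in\mathbb{R}^m$ be generic. Then for every $\varepsilon>0$ there exists $\delta>0$ such that for every $t\in(0,\delta)$: $$T(A_1,\omega_1+t\omega_1')\cap\cdots\cap T(A_n,\omega_n+t\omega_n')\cap B(p,\varepsilon)\neq\emptyset,$$ where $B(p,\varepsilon)\subseteq\mathbb{R}^n$ is the open ball centered at $p$ with radius $\varepsilon$.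
   Context: For a matrix $A\in\mathbb{Z}^{n\times r}$ of exponent vectors and a coefficient vector $\omega\in\mathbb{R}^r$, the tropical hypersurface is $$T(A,\omega):=\{x\in\mathbb{R}^n:\max_{i}(\omega_i+A_{1i}x_1+\cdots+A_{ni}x_n)\text{ is attained at least twice}\}.$$ Generic $\omega'$ means: outside some finite union of proper linear subspaces of $\mathbb{R}^m$. *)

(* Defs.v *)
From HB Require Import structures.
From mathcomp Require Import all_boot all_order all_algebra.
From mathcomp Require Import all_classical all_reals all_analysis.

Set Implicit Arguments.
Unset Strict Implicit.
Unset Printing Implicit Defensive.

Import Order.TTheory GRing.Theory Num.Theory.
Import numFieldNormedType.Exports.

Local Open Scope classical_set_scope.
Local Open Scope ring_scope.

Definition trop_term (R : realType) (n r : nat) (A : 'M[int]_(n, r))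
    (w : 'rV[R]_r) (x : 'cV[R]_n) (j : 'I_r) : R :=
  w 0 j + \sum_(k < n) (A k j)%:~R * x k 0.

Definition trop_argmax (R : realType) (n r : nat) (A : 'M[int]_(n, r))
    (w : 'rV[R]_r) (x : 'cV[R]_n) : {set 'I_r} :=
  [set j : 'I_r |
    [forall l : 'I_r, trop_term A w x l <= trop_term A w x j]]%SET.

(* The indices, not the values, of the maximal terms are counted: repeated
   columns of A count separately. *)
Definition trop_hypersurface (R : realType) (n r : nat) (A : 'M[int]_(n, r))
    (w : 'rV[R]_r) : set 'cV[R]_n :=
  [set x : 'cV[R]_n | (2 <= #|trop_argmax A w x|)%N].

(* A point of R^{m_1} x ... x R^{m_n} is a row vector of length
   m_1 + ... + m_n, whose i-th block is [submxrow w i]. *)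
Definition trop_intersection (R : realType) (n : nat) (m : 'I_n -> nat)
    (A : forall i : 'I_n, 'M[int]_(n, m i)) (w : 'rV[R]_(\sum_i m i)%N) :
    set 'cV[R]_n :=
  \bigcap_(i in [set: 'I_n]) trop_hypersurface (A i) (submxrow w i).

(* The canonical norm on matrices (hence [ball]) is the sup norm; this is the
   Euclidean ball. *)
Definition euclidean_ball (R : realType) (n : nat) (p : 'cV[R]_n) (e : R) :
    set 'cV[R]_n :=
  [set x : 'cV[R]_n | Num.sqrt (\sum_(k < n) (x k 0 - p k 0) ^+ 2) < e].

Definition generically (R : realType) (N : nat) (P : 'rV[R]_N -> Prop) : Prop :=
  exists2 H : seq {vspace 'rV[R]_N},
    forall U : {vspace 'rV[R]_N}, U \in H -> (U != fullv)%VS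
  & forall w : 'rV[R]_N, (forall U : {vspace 'rV[R]_N}, U \in H -> w \notin U) -> P w.

(* Main.v *)
Require Import Defs.
From HB Require Import structures.
From mathcomp Require Import all_boot all_order all_algebra.
From mathcomp Require Import all_classical all_reals all_analysis.
From mathcomp Require Import ring lra.

Set Implicit Arguments.
Unset Strict Implicit.
Unset Printing Implicit Defensive.

Import Order.TTheory GRing.Theory Num.Theory.
Import numFieldNormedType.Exports.

Local Open Scope classical_set_scope.
Local Open Scope ring_scope.

(** Near p only the monomials that attain the maximum at p, say those of the
    set J, compete, so p + t y lies on all perturbed hypersurfaces for small
    t > 0 as soon as y solves the problem for the terms in J alone, with
    coefficients w' ([near_peaks_perturb], [near_trop_intersection]).  Applied
    with w' = 0, the same remark turns the isolation of p into a statement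
    about the homogeneous problem on J: its only solution is y = 0
    ([isolated_homogeneous0]).  It remains to solve the problem on J for w'.

    Compactness reduces this to exponents in general position.  When the
    homogeneous problem has only the zero solution, solutions cannot escape to
    infinity, so solvability survives a limit of exponents and coefficients
    ([doubled_limit]).  Allowing real exponents, those of J are moved by
    t c_l e_i, where e_i is the unit vector of the block i of the term l and
    the c_l are distinct; for all but finitely many t, any choice of
    two distinct terms per block then yields differences of exponents that
    form a basis of R^n
    ([general_position_dense]).

    For exponents in general position every system is solvable, whatever its
    coefficients ([general_position_doubled]), by induction on the number of
    terms.  If every block has two terms, the system is linear and invertible.
    Otherwise a coefficient in a block with three terms or more is raised from
    -oo, where the induction hypothesis for the system without that term
    applies, up to its actual value.  The set of values that admit a solution
    is closed.  If its supremum c were below the target, then the solution at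
    c could be continued a little further by solving the local system of the
    terms that are maximal there, a contradiction.  The local system is smaller
    and falls to the induction hypothesis, unless all terms are maximal at
    once; that case reduces by scaling to a system in which the block of the
    moving term keeps only two terms ([doubled_of_binomial_block]). *)

(** * Tied maxima within blocks *)

Section Peaks.
Variables (R : realType) (n : nat) (I : finType) (b : I -> 'I_n).
Implicit Types (S : {set I}) (v u : I -> R).

(** All terms of the system form one finite type; [b] assigns to a term the
    hypersurface it belongs to, and [S] is the set of terms in play. *)
Definition peaks S v : {set I} :=
  [set j in S | [forall l in S, (b l == b j) ==> (v l <= v j)]]%SET.

Definition doubled S v : Prop :=
  forall i, exists j k,
    [/\ j \in peaks S v, k \in peaks S v, b j = i, b k = i & j != k].

Definition two_per_block S : Prop :=
  forall i, exists j k, [/\ j \in S, k \in S, b j = i, b k = i & j != k].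

Lemma peaksP S v j :
  reflect (j \in S /\ forall l, l \in S -> b l = b j -> v l <= v j)
          (j \in peaks S v).
Proof.
rewrite inE; apply: (iffP andP) => -[jS].
  by move=> /forall_inP H; split=> // l lS e; apply: (implyP (H l lS)); apply/eqP.
by move=> H; split=> //; apply/forall_inP => l lS; apply/implyP => /eqP; apply: H.
Qed.

Lemma peaks_sub S v : peaks S v \subset S.
Proof. by apply/fintype.subsetP => j /peaksP[]. Qed.

Lemma doubled_sub S v S' v' :
  peaks S v \subset peaks S' v' -> doubled S v -> doubled S' v'.
Proof.
move=> /fintype.subsetP sub dbl i; have [j [k [jP kP bj bk jk]]] := dbl i.
by exists j, k; split=> //; apply: sub.
Qed.

Lemma doubled_scale S v c : 0 < c -> doubled S v -> doubled S (fun l => c * v l).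
Proof.
move=> c0; apply: doubled_sub; apply/fintype.subsetP => j /peaksP[jS H].
by apply/peaksP; split=> // l lS e; rewrite ler_pM2l // H.
Qed.

Lemma eq_doubled S v v' : v =1 v' -> doubled S v -> doubled S v'.
Proof. by move=> /funext ->. Qed.

(** A strict inequality between two values is an open condition, so a term
    that is beaten in the limit is already beaten nearby: the set of maximal
    terms is upper semicontinuous. *)
Lemma near_peaks_sub (T : Type) (F : set_system T) {FF : Filter F} S
    (f : T -> I -> R) v :
  (forall l, f x l @[x --> F] --> v l) ->
  \forall x \near F, peaks S (f x) \subset peaks S v.
Proof.
move=> fv.
have H (jl : I * I) : \forall x \near F, v jl.1 < v jl.2 -> f x jl.1 < f x jl.2.
  have [lt|_] := boolP (v jl.1 < v jl.2); last by apply: nearW.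
  have gap : 0 < v jl.2 - v jl.1 by rewrite subr_gt0.
  near=> x => _; rewrite -subr_gt0; near: x.
  exact: cvgr_gt _ (cvgB (fv jl.2) (fv jl.1)) _ gap.
near=> x; apply/fintype.subsetP => j /peaksP[jS fj]; apply/peaksP; split=> // l lS e.
rewrite leNgt; apply/negP => lt.
have := fj l lS e; rewrite leNgt => /negP; apply.
have : forall jl : I * I, v jl.1 < v jl.2 -> f x jl.1 < f x jl.2.
  by near: x; apply: filter_forall.
by move=> /(_ (j, l)); apply.
Unshelve. all: by end_near. Qed.

(** Terms below the maximum of their block stay below it for small [t], and
    among the terms tied at the maximum the order is that of [u]. *)
Lemma near_peaks_perturb S v u :
  \forall t \near (0 : R)^'+,
    peaks (peaks S v) u \subset peaks S (fun l => v l + t * u l).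
Proof.
have H : forall jl : I * I, \forall t \near (0:R)^'+,
    v jl.1 < v jl.2 -> v jl.1 + t * u jl.1 < v jl.2 + t * u jl.2.
  move=> [j l] /=.
  have [lt|_] := boolP (v j < v l); last by apply: nearW.
  have c : forall m, v m + t * u m @[t --> (0:R)^'+] --> v m.
    move=> m; apply: cvg_at_right_filter.
    rewrite -[X in _ --> X]addr0 -[X in _ --> _ + X](mul0r (u m)).
    by apply: cvgD; [exact: cvg_cst | apply: cvgM; [exact: cvg_id | exact: cvg_cst]].
  have gap : 0 < v l - v j by rewrite subr_gt0.
  near=> x => _; rewrite -subr_gt0; near: x.
  exact: cvgr_gt _ (cvgB (c l) (c j)) _ gap.
near=> t; apply/fintype.subsetP => j /peaksP[/peaksP[jS vj] uj].
apply/peaksP; split=> // l lS e.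
have [lt|ge] := ltP (v l) (v j).
  have : forall jl : I * I,
      v jl.1 < v jl.2 -> v jl.1 + t * u jl.1 < v jl.2 + t * u jl.2.
    by near: t; apply: filter_forall.
  by move=> /(_ (l, j) lt) /ltW.
apply: lerD; first exact: vj.
rewrite ler_pM2l //; apply: uj => //; apply/peaksP; split=> // m mS em.
by apply: le_trans ge; apply: vj; rewrite // em.
Unshelve. all: by end_near. Qed.

End Peaks.

(** * Passing to the limit *)

Section Limits.
Variables (R : realType) (n : nat) (I : finType) (b : I -> 'I_n).
Implicit Types (S : {set I}) (a : I -> 'rV[R]_n) (w : I -> R) (x y : 'cV[R]_n).

Definition affine_value a w x l : R := w l + (a l *m x) 0 0.

Lemma affine_valueZ a w x c l :
  affine_value a (fun l => c * w l) (c *: x) l = c * affine_value a w x l.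
Proof. by rewrite /affine_value -scalemxAr mxE mulrDr. Qed.

Lemma affine_valueD a w x u y t l :
  affine_value a (fun l => w l + t * u l) (x + t *: y) l =
  affine_value a w x l + t * affine_value a u y l.
Proof.
by rewrite /affine_value mulmxDr -scalemxAr !mxE mulrDr addrACA.
Qed.

Lemma compact_half_sphere :
  compact [set z : 'rV[R]_n * R | `|z| = 1 /\ 0 <= z.2].
Proof.
have cE : compact ([set x : 'rV[R]_n | `|x| <= 1] `*` `[(0:R), 1]).
  apply: compact_setX; last exact: segment_compact.
  apply: bounded_closed_compact.
    by exists 1; split=> // M M1 x /= /le_trans; apply; apply: ltW.
  exact: (continuous_closedP _).1 (@norm_continuous R 'rV[R]_n) _ (@closed_le R 1).
apply: subclosed_compact cE _.
  apply: closedI.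
    exact: (continuous_closedP _).1 (@norm_continuous R ('rV[R]_n * R)%type) _ (@closed_eq R 1).
  apply: (continuous_closedP snd).1 _ _ (@closed_ge R 0) => z; exact: cvg_snd.
move=> [x h] [/= + h0]; rewrite prod_normE /= => N; split=> /=.
  by rewrite -N le_max lexx.
rewrite in_itv /= h0 /= -N le_max; apply/orP; right.
exact: ler_norm.
Qed.

(** Solutions are homogenized to pairs (x, h) with h >= 0 and norm 1, where h
    multiplies the coefficients.  These pairs range over a compact set, hence
    accumulate at some (x, h) for [t0].  If h = 0, then x is a nonzero
    solution of the homogeneous problem; otherwise x / h is a solution. *)
Lemma doubled_limit S (a : R -> I -> 'rV[R]_n) (w : R -> I -> R) t0 :
  (forall l k, a t l 0 k @[t --> t0] --> a t0 l 0 k) ->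
  (forall l, w t l @[t --> t0] --> w t0 l) ->
  (forall x, doubled b S (affine_value (a t0) (fun=> 0) x) -> x = 0) ->
  (forall d, 0 < d -> exists2 t, `|t0 - t| < d &
     exists x, doubled b S (affine_value (a t) (w t) x)) ->
  exists x, doubled b S (affine_value (a t0) (w t0) x).
Proof.
move=> ca cw homogeneous0 solvable.
pose val t (z : 'rV[R]_n * R) := affine_value (a t) (fun l => z.2 * w t l) z.1^T.
have [[z [[z1 z0] dbl]]|none] := pselect (exists z : 'rV[R]_n * R,
    (`|z| = 1 /\ 0 <= z.2) /\ doubled b S (val t0 z)).
  have [h0|hpos] := eqVneq z.2 0.
    have x0 : z.1^T = 0.
      apply: homogeneous0; apply: eq_doubled dbl => l.
      by rewrite /val /affine_value h0 mul0r.
    move: z1; rewrite prod_normE h0 -[z.1]trmxK x0 trmx0 !normr0 maxxx => /eqP.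
    by rewrite eq_sym oner_eq0.
  have {}hpos : 0 < z.2 by rewrite lt_neqAle eq_sym hpos.
  exists (z.2^-1 *: z.1^T); have := doubled_scale (c := z.2^-1) _ dbl.
  rewrite invr_gt0 => /(_ hpos); apply: eq_doubled => l.
  rewrite /val -affine_valueZ; congr (_ + _).
  by rewrite mulrA mulVf ?gt_eqF // mul1r.
exfalso.
(* Without a homogenized solution at t0, each point of the half sphere has a
   neighbourhood without solutions for t near t0; by compactness the whole half
   sphere is free of solutions for t near t0. *)
have /compact_near_coveringP cov := compact_half_sphere.
have /nbhs_ballP[d /= d0 near_none] : \forall t \near t0,
    [set z : 'rV[R]_n * R | `|z| = 1 /\ 0 <= z.2] `<=`
    (fun z => ~ doubled b S (val t z)).
  apply: (cov R (nbhs t0) (fun t z => ~ doubled b S (val t z))) => z Kz.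
  have ndbl : ~ doubled b S (val t0 z).
    by move=> dbl; apply: none; exists z.
  apply: filterS (near_peaks_sub (F := filter_prod (nbhs z) (nbhs t0)) b S
      (f := fun zt => val zt.2 zt.1) (v := val t0 z) _).
    by move=> [z' t] /= sub /(doubled_sub sub).
  move=> l; apply: cvgD.
    by apply: cvgM; [apply: cvg_comp cvg_fst _; exact: cvg_snd
                    |exact: cvg_comp cvg_snd (cw l)].
  rewrite mxE; under eq_fun do rewrite mxE.
  apply: cvg_big => [|k _]; first exact: add_continuous.
  apply: cvgM; first exact: cvg_comp cvg_snd (ca l k).
  rewrite mxE; under eq_fun do rewrite mxE.
  have fst2 : zt.1.1 @[zt --> filter_prod (nbhs z) (nbhs t0)] --> z.1.
    exact: cvg_comp cvg_fst (@cvg_fst _ _ (nbhs z.1) (nbhs z.2) _).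
  exact: cvg_comp fst2 (@coord_continuous R _ _ 0 k z.1).
have [t td [x dbl]] := solvable d d0.
have := near_none t td.
pose c := Num.max `|x^T| 1.
have c0 : 0 < c by rewrite lt_max ltr01 orbT.
move=> /(_ (c^-1 *: (x^T, 1))); apply => /=.
  split; last by apply: mulr_ge0; rewrite ?invr_ge0 ?ler01 ?ltW.
  rewrite normrZ gtr0_norm ?invr_gt0 // prod_normE /= normr1 -/c.
  by rewrite mulVf // gt_eqF.
have := doubled_scale (c := c^-1) _ dbl.
rewrite invr_gt0 => /(_ c0); apply: eq_doubled => l.
rewrite -affine_valueZ /val /= linearZ /= trmxK.
congr (_ * _ + _); exact/esym/mulr1.
Qed.

End Limits.

(** * Exponents in general position *)

Section GeneralPosition.
Variables (R : realType) (n : nat) (I : finType) (b : I -> 'I_n).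
Implicit Types (S : {set I}) (a : I -> 'rV[R]_n) (w : I -> R) (x y : 'cV[R]_n).

Definition general_position a : Prop :=
  forall j k : 'I_n -> I, (forall i, b (j i) = i) -> (forall i, b (k i) = i) ->
    (forall i, j i != k i) -> \matrix_i (a (j i) - a (k i)) \in unitmx.

Lemma difference_mulE a (j k : 'I_n -> I) x i :
  (\matrix_i (a (j i) - a (k i)) *m x) i 0 =
  (a (j i) *m x) 0 0 - (a (k i) *m x) 0 0.
Proof.
by rewrite !mxE -sumrB; apply: eq_bigr => m _; rewrite !mxE mulrBl.
Qed.

Lemma two_per_block_choice S : two_per_block b S ->
  exists j k : 'I_n -> I, forall i,
    [/\ j i \in S, k i \in S, b (j i) = i, b (k i) = i & j i != k i].
Proof.
by move=> /fin_all_exists[j /fin_all_exists[k jk]]; exists j, k.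
Qed.

Lemma general_position_homogeneous0 a S x : general_position a ->
  doubled b S (affine_value a (fun=> 0) x) -> x = 0.
Proof.
move=> gp dbl; have [j [k jk]] := two_per_block_choice dbl.
have Mu : \matrix_i (a (j i) - a (k i)) \in unitmx.
  by apply: gp => i; have [] := jk i.
rewrite -[x](mulKmx Mu) [X in _ *m X](_ : _ = 0) ?mulmx0 //.
apply/colP => i; rewrite difference_mulE [RHS]mxE; apply/eqP.
have [/peaksP[jS jP] /peaksP[kS kP] bj bk _] := jk i.
have := jP _ kS (etrans bk (esym bj)); have := kP _ jS (etrans bj (esym bk)).
by rewrite /affine_value !add0r subr_eq0 eq_le => -> ->.
Qed.

Lemma doubled_of_pairs a S w : general_position a -> two_per_block b S ->
  (forall j l q, j \in S -> l \in S -> q \in S -> b l = b j -> b q = b j ->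
     [|| l == j, q == j | q == l]) ->
  exists x, doubled b S (affine_value a w x).
Proof.
move=> gp two only2; have [j [k jk]] := two_per_block_choice two.
have Mu : \matrix_i (a (j i) - a (k i)) \in unitmx.
  by apply: gp => i; have [] := jk i.
pose x := invmx (\matrix_i (a (j i) - a (k i))) *m (\col_i (w (k i) - w (j i))).
have tie i : affine_value a w x (j i) = affine_value a w x (k i).
  have := difference_mulE a j k x i; rewrite mulKVmx // mxE /affine_value.
  by move=> e; lra.
exists x => i; have [jS kS bj bk nejk] := jk i.
have other l : l \in S -> b l = i -> l = j i \/ l = k i.
  move=> lS bl; have /or3P[/eqP|/eqP|/eqP] :=
    only2 _ _ _ jS kS lS (etrans bk (esym bj)) (etrans bl (esym bj)).
  - by move=> e; rewrite e eqxx in nejk.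
  - by left.
  - by right.
exists (j i), (k i); split=> //; apply/peaksP; split=> // l lS.
  by rewrite bj => /(other l lS)[->|->]; rewrite ?tie.
by rewrite bk => /(other l lS)[->|->]; rewrite ?tie.
Qed.

(** Keep only [j] and [l] in the block of [j].  A solution [y] for the
    coefficients that are 1 at [j] and 0 elsewhere makes these two terms tie:
    1 + a_j y = a_l y.  The blocks other than that of [j] are homogeneous, so
    [y] may be rescaled by any positive factor there.  With all terms back in
    the block of [j], dividing [y] by h, the largest (a_q - a_j) y with
    q <> j, makes the best competitor tie with [j]; the tie of [l] gives
    h >= 1 > 0. *)
Lemma doubled_of_binomial_block a S j l y :
  j \in S -> l \in S -> b l = b j -> l != j ->
  doubled b [set q in S | (b q == b j) ==> ((q == j) || (q == l))]%SET
    (affine_value a (fun q => (q == j)%:R) y) ->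
  exists z, doubled b S (affine_value a (fun q => (q == j)%:R) z).
Proof.
move=> jS lS bl lj dbl.
have tie : 1 + (a j *m y) 0 0 <= (a l *m y) 0 0.
  have [p [q [/peaksP[]]]] := dbl (b j).
  rewrite inE => /andP[pS /implyP pjl] pP /peaksP[].
  rewrite inE => /andP[qS /implyP qjl] qP bp bq pq.
  have jT : j \in [set q in S | (b q == b j) ==> ((q == j) || (q == l))]%SET.
    by rewrite inE jS !eqxx.
  rewrite bp bq !eqxx in pjl qjl; have := pjl isT; have := qjl isT.
  case/orP=> /eqP ?; case/orP=> /eqP ?; subst p q; rewrite ?eqxx // in pq *.
    by have := pP j jT (esym bp); rewrite /affine_value eqxx (negbTE lj) add0r.
  by have := qP j jT (esym bq); rewrite /affine_value eqxx (negbTE lj) add0r.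
have Pl : [&& l \in S, b l == b j & l != j] by rewrite lS bl eqxx lj.
pose m := [arg max_(m > l | [&& m \in S, b m == b j & m != j]) (a m *m y) 0 0]%O.
have [mS bm mj mmax] : [/\ m \in S, b m = b j, m != j &
    forall q, q \in S -> b q = b j -> q != j -> (a q *m y) 0 0 <= (a m *m y) 0 0].
  rewrite /m; case: arg_maxP => // q /and3P[qS /eqP bq qj] qmax; split=> //.
  by move=> r rS br rj; apply: qmax; rewrite rS br eqxx rj.
pose h := (a m *m y) 0 0 - (a j *m y) 0 0.
have h0 : 0 < h by have := mmax l lS bl lj; rewrite /h; lra.
have scaled q : (a q *m (h^-1 *: y)) 0 0 = h^-1 * (a q *m y) 0 0.
  by rewrite -scalemxAr mxE.
have mtie : h^-1 * (a m *m y) 0 0 = 1 + h^-1 * (a j *m y) 0 0.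
  by rewrite -[1](mulVf (lt0r_neq0 h0)) -mulrDr; congr (_ * _); rewrite /h; lra.
exists (h^-1 *: y) => i; have [->|ij] := eqVneq i (b j).
  have top q : q \in S -> b q = b j -> affine_value a (fun q => (q == j)%:R)
      (h^-1 *: y) q <= 1 + h^-1 * (a j *m y) 0 0.
    move=> qS bq; rewrite /affine_value scaled; have [->//|qj] := eqVneq q j.
    by rewrite add0r -mtie ler_pM2l ?invr_gt0 // mmax.
  exists j, m; split=> //; last by rewrite eq_sym.
    by apply/peaksP; split=> // q qS bq; rewrite {2}/affine_value scaled eqxx top.
  apply/peaksP; split=> // q qS; rewrite bm => bq.
  by rewrite {2}/affine_value scaled (negbTE mj) add0r mtie top.
have [p [q [pP qP bp bq pq]]] := dbl i.
have off r : b r = i -> affine_value a (fun q => (q == j)%:R) (h^-1 *: y) r =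
    h^-1 * affine_value a (fun q => (q == j)%:R) y r.
  move=> br; rewrite /affine_value scaled; have [rj|_] := eqVneq r j.
    by rewrite -br rj eqxx in ij.
  by rewrite !add0r.
have peak r : b r = i ->
    r \in peaks b [set q in S | (b q == b j) ==> ((q == j) || (q == l))]%SET
      (affine_value a (fun q => (q == j)%:R) y) ->
    r \in peaks b S (affine_value a (fun q => (q == j)%:R) (h^-1 *: y)).
  move=> br /peaksP[+ rP]; rewrite inE => /andP[rS _].
  apply/peaksP; split=> // s sS; rewrite br => bs.
  rewrite !off // ler_pM2l ?invr_gt0 //; apply: rP; last by rewrite bs br.
  by rewrite inE sS bs (negbTE ij).
by exists p, q; split=> //; apply: peak.
Qed.

(** The condition on [S] is the only obstruction: general position passes to
    all subsystems, which is what lets the induction remove terms. *)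
Theorem general_position_doubled a : general_position a ->
  forall S w, two_per_block b S -> exists x, doubled b S (affine_value a w x).
Proof.
move=> gp S; have [N] := ubnP #|S|; elim: N S => // N IH S; rewrite ltnS => SN w two.
have IHproper S' w' : S' \proper S -> two_per_block b S' ->
    exists x, doubled b S' (affine_value a w' x).
  by move=> /proper_card lt; apply: IH; apply: leq_trans lt SN.
have [[j [l [q [[jS lS qS] [bl bq lj qj ql]]]]]|no3] := pselect (exists j l q,
    [/\ j \in S, l \in S & q \in S] /\
    [/\ b l = b j, b q = b j, l != j, q != j & q != l]); last first.
  apply: doubled_of_pairs => // j l q jS lS qS bl bq.
  apply: contrapT => /negP; rewrite !negb_or => /and3P[lj qj ql].
  by apply: no3; exists j, l, q.
(* The homotopy: the coefficient of j is c, the others are those of w. *)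
pose W c l0 := if l0 == j then c else w l0.
pose E := [set c | c <= w j /\ exists x, doubled b S (affine_value a (W c) x)].
(* A solution without j remains one as long as the term j stays below the
   maximum p of its block. *)
have E0 : E !=set0.
  have [||x dbl] := IHproper (S :\ j)%SET w.
  - by rewrite properD1.
  - move=> i; have [->|ij] := eqVneq i (b j).
      by exists l, q; rewrite !inE lj qj lS qS; split=> //; rewrite eq_sym.
    have [p [r [pS rS bp br pr]]] := two i; exists p, r; rewrite !inE pS rS !andbT.
    by split=> //; [apply: contraNneq ij => <-; rewrite bp
                   |apply: contraNneq ij => <-; rewrite br].
  have [p [_ [pP _ bp _ _]]] := dbl (b j).
  pose c := Num.min (w j) (affine_value a w x p - (a j *m x) 0 0).
  exists c; split; first by rewrite ge_min lexx.
  exists x; apply: doubled_sub dbl; apply/fintype.subsetP => r.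
  move=> /peaksP[/setD1P[rj rS] rP]; apply/peaksP; split=> // s sS bs.
  rewrite {2}/affine_value /W (negbTE rj) -/(affine_value a w x r).
  rewrite /affine_value; have [sj|sj] := eqVneq s j; last first.
    by apply: rP; rewrite // !inE sj.
  subst s; rewrite -lerBrDr; apply: le_trans (_ : c <= _) _ => //.
  rewrite /c ge_min; apply/orP; right; rewrite lerB //.
  have /peaksP[pS _] := pP; by apply: rP => //; rewrite bp.
have ubE : ubound E (w j) by move=> c [].
have supE : has_sup E by split=> //; exists (w j).
have [x dbl] : exists x, doubled b S (affine_value a (W (sup E)) x).
  apply: (doubled_limit (a := fun=> a) (w := W)).
  - by move=> *; exact: cvg_cst.
  - move=> r; rewrite /W; case: eqP => _; [exact: cvg_id|exact: cvg_cst].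
  - by move=> x; apply: general_position_homogeneous0.
  move=> d d0; have [c Ec cd] := sup_adherent d0 supE; have [_ ex] := Ec.
  exists c => //; have := ub_le_sup supE.2 Ec; rewrite -subr_ge0 => h.
  by rewrite ger0_norm //; lra.
have := ge_sup E0 ubE; rewrite le_eqVlt => /predU1P[e|lt].
  by exists x; apply: eq_doubled dbl => r; rewrite /affine_value /W e; case: eqP => [->|].
exfalso.
pose v := affine_value a (W (sup E)) x.
(* A direction y along which the solution x at the supremum continues when the
   coefficient of j grows. *)
have [y ydbl] : exists y, doubled b (peaks b S v)
    (affine_value a (fun r => (r == j)%:R) y).
  have := peaks_sub b S v; rewrite subEproper => /predU1P[->|pr]; last first.
    by apply: IHproper => //; exact: dbl.
  have [||y] := IHproper
    [set r in S | (b r == b j) ==> ((r == j) || (r == l))]%SET (fun r => (r == j)%:R).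
  - apply/properP; split; first by apply/fintype.subsetP => r; rewrite inE => /andP[].
    by exists q; rewrite // inE qS bq eqxx (negbTE qj) (negbTE ql).
  - move=> i; have [->|ij] := eqVneq i (b j).
      by exists j, l; rewrite !inE jS lS !eqxx !orbT !implybT; split; rewrite // eq_sym.
    have [p [r [pS rS bp br pr]]] := two i; exists p, r.
    by rewrite !inE pS rS bp br (negbTE ij).
  exact: doubled_of_binomial_block.
have [t [t0 tlt sub]] : exists t : R, [/\ 0 < t, t < w j - sup E &
    peaks b (peaks b S v) (affine_value a (fun r => (r == j)%:R) y) \subset
    peaks b S (fun r => v r + t * affine_value a (fun r => (r == j)%:R) y r)].
  near (0:R)^'+ => t; exists t; split=> //.
    by near: t; apply: nbhs_right_lt; rewrite subr_gt0.
  by near: t; exact: near_peaks_perturb.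
suff /(ub_le_sup supE.2) : E (sup E + t) by rewrite leNgt ltrDl t0.
split; first by rewrite addrC -lerBrDr ltW.
exists (x + t *: y); apply: eq_doubled (doubled_sub sub ydbl) => r.
rewrite -affine_valueD; congr (_ + _); rewrite /W.
by case: eqP => _; rewrite ?mulr1 // mulr0 addr0.
Unshelve. all: by end_near. Qed.

End GeneralPosition.

(** * Moving exponents into general position *)

Section Perturbation.
Variables (R : realType) (n : nat) (I : finType) (b : I -> 'I_n).

Lemma small_nonroot (p : {poly R}) d : p != 0 -> 0 < d ->
  exists2 t, 0 < t < d & ~~ root p t.
Proof.
move=> p0 d0; pose s := [seq d / i.+2%:R | i <- iota 0 (size p)].
have /allPn[t /mapP[i _ ->] nr] : ~~ all (root p) s.
  apply: contra p0 => roots; apply/eqP; apply: (roots_geq_poly_eq0 roots).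
    rewrite map_inj_uniq ?iota_uniq // => i j /(mulfI (lt0r_neq0 d0)) /invr_inj.
    by move/eqP; rewrite eqr_nat => /eqP[].
  by rewrite size_map size_iota.
exists (d / i.+2%:R) => //; rewrite divr_gt0 ?ltr0n //=.
by rewrite gtr_pMr // invf_lt1 ?ltr0n // ltr1n.
Qed.

(** D + t diag(c) = diag(c) (N + t) with N = diag(c)^-1 D, which is singular
    only when t is an eigenvalue of - N. *)
Lemma unitmx_add_diag (D : 'M[R]_n) (c : 'rV[R]_n) t :
  (forall i, c 0 i != 0) ->
  ~~ root (char_poly (- (invmx (diag_mx c) *m D))) t ->
  D + t *: diag_mx c \in unitmx.
Proof.
move=> c0; set N := invmx _ *m D.
have cu : diag_mx c \in unitmx.
  by rewrite unitmxE det_diag unitfE; apply/prodf_neq0 => i _.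
rewrite -eigenvalue_root_char /eigenvalue /eigenspace negbK kermx_eq0.
rewrite row_free_unit => u.
have -> : D + t *: diag_mx c = diag_mx c *m (- (- N - t%:M)).
  rewrite opprD !opprK mulmxDr mulmxA mulmxV // mul1mx.
  by rewrite mul_mx_scalar.
by rewrite unitmx_mul cu -scaleN1r unitmxZ // unitrN1.
Qed.

(** The shift of a term is a multiple of the unit vector of its block, so a
    choice of one difference per block is shifted by a diagonal matrix, whose
    entries do not vanish because [c] is injective.  Each of the finitely many
    choices excludes finitely many [t]. *)
Lemma general_position_dense (a : I -> 'rV[R]_n) (c : I -> R) d :
  injective c -> 0 < d -> exists2 t, 0 < t < d &
  general_position b (fun l => a l + t *: (c l *: delta_mx 0 (b l))).
Proof.
move=> c_inj d0.
pose D (jk : {ffun 'I_n -> I} * {ffun 'I_n -> I}) : 'M[R]_n :=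
  \matrix_i (a (jk.1 i) - a (jk.2 i)).
pose g (jk : {ffun 'I_n -> I} * {ffun 'I_n -> I}) : 'rV[R]_n :=
  \row_i (c (jk.1 i) - c (jk.2 i)).
pose q jk := char_poly (- (invmx (diag_mx (g jk)) *m D jk)).
have q0 : \prod_jk q jk != 0.
  by apply/prodf_neq0 => jk _; rewrite monic_neq0 // char_poly_monic.
have [t td nr] := small_nonroot q0 d0; exists t => // j k bj bk jk.
pose f := ([ffun i => j i], [ffun i => k i]) : {ffun 'I_n -> I} * {ffun 'I_n -> I}.
rewrite [X in X \in _](_ : _ = D f + t *: diag_mx (g f)).
  apply: unitmx_add_diag.
    by move=> i; rewrite mxE !ffunE subr_eq0 (inj_eq c_inj).
  by apply: contra nr; rewrite (bigD1 f) //= rootM => ->.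
apply/matrixP => i r; rewrite !mxE !ffunE /= bj bk eq_sym -mulr_natr.
ring.
Qed.

End Perturbation.

(** * Tropical hypersurfaces near an isolated point *)

Section TropicalIntersection.
Variables (R : realType) (n : nat) (m : 'I_n -> nat).
Variable A : forall i : 'I_n, 'M[int]_(n, m i).
Implicit Types (w : 'rV[R]_(\sum_i m i)%N) (x : 'cV[R]_n).
Local Notation term := {i : 'I_n & 'I_(m i)}.

Definition exponent (l : term) : 'rV[R]_n :=
  \row_k (A (tag l) k (tagged l))%:~R.

Definition coefficient w (l : term) : R := submxrow w (tag l) 0 (tagged l).

Lemma affine_value_trop_term w x i (j : 'I_(m i)) :
  affine_value exponent (coefficient w) x (Tagged (fun i => 'I_(m i)) j) =
  trop_term (A i) (submxrow w i) x j.
Proof.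
by rewrite /affine_value mxE; congr (_ + _); apply: eq_bigr => k _; rewrite mxE.
Qed.

Lemma coefficientD w u t l :
  coefficient (w + t *: u) l = coefficient w l + t * coefficient u l.
Proof. by rewrite /coefficient !mxE. Qed.

Lemma peaks_trop_argmax w x i (j : 'I_(m i)) :
  (Tagged (fun i => 'I_(m i)) j \in
     peaks tag [set: term]%SET (affine_value exponent (coefficient w) x)) =
  (j \in trop_argmax (A i) (submxrow w i) x).
Proof.
rewrite [RHS]inE; apply/peaksP/forallP => [[_ jP] l|jP].
  by rewrite -!affine_value_trop_term; apply: jP.
split=> // -[i' l] _ /= ei; subst i'.
by rewrite (affine_value_trop_term w x l) affine_value_trop_term.
Qed.

Lemma trop_intersectionE w x :
  trop_intersection A w x <->
  doubled tag [set: term]%SET (affine_value exponent (coefficient w) x).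
Proof.
split=> [T i|T i _].
  have /card_gt1P[j [k [jT kT jk]]] := T i I.
  exists (Tagged (fun i => 'I_(m i)) j), (Tagged (fun i => 'I_(m i)) k).
  by rewrite !peaks_trop_argmax; split=> //; rewrite eq_Tagged.
have [[i1 j] [[i2 k] [jT kT /= e1 e2 jk]]] := T i; subst i1 i2.
apply/card_gt1P; exists j, k.
rewrite -!peaks_trop_argmax; split=> //.
by apply: contraNneq jk => ->.
Qed.

Lemma near_trop_intersection w u x y :
  doubled tag
    (peaks tag [set: term]%SET
       (affine_value exponent (coefficient w) x))
    (affine_value exponent (coefficient u) y) ->
  \forall t \near (0 : R)^'+, trop_intersection A (w + t *: u) (x + t *: y).
Proof.
move=> dbl; near=> t; apply/trop_intersectionE.
have sub : peaks tag (peaks tag [set: term]%SET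
      (affine_value exponent (coefficient w) x))
      (affine_value exponent (coefficient u) y) \subset
    peaks tag [set: term]%SET
      (fun l => affine_value exponent (coefficient w) x l +
      t * affine_value exponent (coefficient u) y l).
  by near: t; exact: near_peaks_perturb.
apply: eq_doubled (doubled_sub sub dbl) => l.
by rewrite -affine_valueD; congr (_ + _); rewrite coefficientD.
Unshelve. all: by end_near. Qed.

(** The homogeneous problem is a cone: a solution [y] would put the whole
    segment of points p + t y, t small, on the hypersurfaces. *)
Lemma isolated_homogeneous0 w p : isolated (trop_intersection A w) p ->
  forall y, doubled tag
    (peaks tag [set: term]%SET (affine_value exponent (coefficient w) p))
    (affine_value exponent (fun=> 0) y) -> y = 0.
Proof.
move=> [_ [V Vp VT]] y; rewrite (_ : (fun=> 0) = coefficient 0); last first.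
  by apply/funext => l; rewrite /coefficient !mxE.
move=> dbl.
have [t t0 pt] : exists2 t : R, 0 < t & p + t *: y = p.
  have cv : p + t *: y @[t --> (0:R)^'+] --> p.
    apply: cvg_at_right_filter.
    rewrite [X in _ --> X](_ : p = p + (0 : R) *: y); last first.
      by rewrite scale0r addr0.
    by apply: cvgD; [exact: cvg_cst|apply: cvgZ; [exact: cvg_id|exact: cvg_cst]].
  near (0:R)^'+ => t; exists t => //.
  suff : (V `&` trop_intersection A w) (p + t *: y) by rewrite VT.
  split; first by near: t; exact: cv.
  rewrite -[w]addr0 -(scaler0 _ t); near: t; exact: near_trop_intersection.
move/eqP: pt; rewrite -subr_eq0 addrAC subrr add0r scaler_eq0 gt_eqF //=.
by move/eqP.
Unshelve. all: by end_near. Qed.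

Lemma near_euclidean_ball (p y : 'cV[R]_n) e : 0 < e ->
  \forall t \near (0 : R)^'+, euclidean_ball p e (p + t *: y).
Proof.
move=> e0; set c := Num.sqrt (\sum_(k < n) (y k 0) ^+ 2).
have c1 : 0 < c + 1 by rewrite ltr_wpDl ?sqrtr_ge0.
near=> t; rewrite /euclidean_ball /=.
have t0 : 0 < t by [].
have -> : \sum_(k < n) ((p + t *: y) k 0 - p k 0) ^+ 2 =
    t ^+ 2 * \sum_(k < n) (y k 0) ^+ 2.
  by rewrite mulr_sumr; apply: eq_bigr => k _; rewrite !mxE; ring.
rewrite sqrtrM ?sqr_ge0 // sqrtr_sqr gtr0_norm // -/c.
apply: le_lt_trans (_ : t * (c + 1) < e); first by rewrite ler_pM2l // lerDl.
rewrite -ltr_pdivlMr //; near: t; apply: nbhs_right_lt; exact: divr_gt0.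
Unshelve. all: by end_near. Qed.

End TropicalIntersection.

Theorem theorem9p7 (R : realType) (n : nat) (m : 'I_n -> nat)
    (A : forall i : 'I_n, 'M[int]_(n, m i))
    (w : 'rV[R]_(\sum_i m i)%N) (p : 'cV[R]_n)
    (hp : isolated (trop_intersection A w) p) :
  generically (fun w' : 'rV[R]_(\sum_i m i)%N =>
    forall e : R, 0 < e ->
    exists2 d : R, 0 < d &
      forall t : R, 0 < t < d ->
        trop_intersection A (w + t *: w') `&` euclidean_ball p e !=set0).
Proof.
exists [::] => // w' _ e e0.
pose J := peaks tag [set: {i : 'I_n & 'I_(m i)}]%SET
  (affine_value (exponent R A) (coefficient w) p).
have two : two_per_block tag J.
  by have /trop_intersectionE := isolatedS hp.
have [x dbl] : exists x,
    doubled tag J (affine_value (exponent R A) (coefficient w') x).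
  (* Enumeration ranks serve as distinct real numbers attached to the terms. *)
  pose c (l : {i : 'I_n & 'I_(m i)}) : R := (enum_rank l)%:R.
  have c_inj : injective c.
    by move=> l l' /eqP; rewrite eqr_nat => /eqP/val_inj/enum_rank_inj.
  pose a t l := exponent R A l + t *: (c l *: delta_mx 0 (tag l)).
  have a0 : a 0 = exponent R A by apply/funext => l; rewrite /a scale0r addr0.
  rewrite -a0; apply: (doubled_limit (w := fun=> coefficient w')).
  - move=> l k; rewrite mxE; under eq_fun do rewrite mxE.
    apply: cvgD; first exact: cvg_cst.
    rewrite mxE; under eq_fun do rewrite mxE.
    by apply: cvgM; [exact: cvg_id|exact: cvg_cst].
  - by move=> l; exact: cvg_cst.
  - by rewrite a0; exact: isolated_homogeneous0 hp.
  move=> d d0.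
  have [t /andP[t0 td] gp] := general_position_dense tag (exponent R A) c_inj d0.
  exists t; first by rewrite sub0r normrN gtr0_norm.
  exact: general_position_doubled.
have : \forall t \near (0:R)^'+,
    (trop_intersection A (w + t *: w') `&` euclidean_ball p e) (p + t *: x).
  near=> t; split; near: t; last exact: near_euclidean_ball.
  exact: near_trop_intersection.
move=> /nbhs_ballP[d /= d0 H]; exists d => // t /andP[t0 td].
exists (p + t *: x); apply: H => //.
by rewrite /ball /= sub0r normrN gtr0_norm.
Unshelve. all: by end_near. Qed.
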